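(* Let $\mathcal{C}$ be an abelian category, let $\mathcal{U}\subseteq\mathcal{V}\subseteq\mathcal{C}$ be classes of objects which are closed under extensions, let $\omega$ be a relative generator in $\mathcal{U}$, and let $0\in\mathcal{U}$. Then the following statements hold true. (a) For any $Z\in\mathcal{U}_{\mathcal{V}}^{\vee}$, with $n:=\mathrm{coresdim}_{\mathcal{U}}^{\mathcal{V}}(Z)$, there are short exact sequences $$0\to Z\xrightarrow{g_Z}M_Z\to C_Z\to 0\quad\text{with } C_Z\in(\mathcal{V},\omega)^{\vee},\ M_Z\in\mathcal{U},$$ $$0\to K_Z\to B_Z\xrightarrow{f_Z}Z\to 0\quad\text{with } B_Z\in\omega_{\mathcal{V}}^{\vee},\ K_Z\in\mathcal{U},$$ where $\mathrm{coresdim}_{\omega}^{\mathcal{V}}(C_Z)=n-1$ and $\mathrm{coresdim}_{\omega}^{\mathcal{V}}(B_Z)\leq n$. (Here the expression $\mathrm{coresdim}_{\omega}^{\mathcal{V}}(C_Z)=-1$, occurring when $n=0$, just means that $C_Z=0$.) (b) For the sequences in (a): $B_Z\in(\mathcal{V},\omega)^{\vee}$ if $Z\in(\mathcal{V},\mathcal{U})^{\vee}$. (c) Let $\omega\subseteq{}^{\perp}\mathcal{U}$. Then $\omega^{\vee}\subseteq{}^{\perp}\mathcal{U}$ and, for the sequences in (a), $f_Z$ is an $\omega^{\vee}$-precover and $g_Z$ is a $\mathcal{U}$-preenvelope.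
   Context: $\mathrm{Ext}^i_{\mathcal{C}}$ denotes Yoneda Ext; ${}^{\perp}\mathcal{U}:=\{C\in\mathcal{C} : \mathrm{Ext}^i_{\mathcal{C}}(C,U)=0\ \forall U\in\mathcal{U},\ \forall i\ge1\}$. $\omega$ is a relative generator in $\mathcal{U}$ if $\omega\subseteq\mathcal{U}$ and every $U\in\mathcal{U}$ admits an exact sequence $0\to U'\to W\to U\to0$ with $W\in\omega$ and $U'\in\mathcal{U}$. For a class $\mathcal{Z}$, a morphism $f:Z\to M$ is a $\mathcal{Z}$-precover if $Z\in\mathcal{Z}$ and $\mathrm{Hom}_{\mathcal{C}}(Z',f)$ is surjective for all $Z'\in\mathcal{Z}$; dually, $g:M\to Z$ is a $\mathcal{Z}$-preenvelope if $Z\in\mathcal{Z}$ and $\mathrm{Hom}_{\mathcal{C}}(g,Z')$ is surjective for all $Z'\in\mathcal{Z}$. For classes $\mathcal{P},\mathcal{Q}\subseteq\mathcal{C}$ and $M\in\mathcal{C}$, a $\mathcal{Q}_{\mathcal{P}}$-coresolution of length $n$ of $M$ is an exact sequence $0\to M\xrightarrow{f_0}Q_0\xrightarrow{f_1}Q_1\to\cdots\to Q_{n-1}\xrightarrow{f_n}Q_n\to0$ with $Q_n\in\mathcal{P}\cap\mathcal{Q}$, $Q_k\in\mathcal{Q}$ for $0\le k\le n-1$, and $\mathrm{Im}(f_i)\in\mathcal{P}$ for $1\le i\le n-1$. $\mathrm{coresdim}_{\mathcal{Q}}^{\mathcal{P}}(M)$ is the smallest $n\ge0$ such that $M$ has a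 $\mathcal{Q}_{\mathcal{P}}$-coresolution of length $n$ ($\infty$ if none exists). $\mathcal{Q}_{\mathcal{P}}^{\vee}$ is the class of objects having a finite $\mathcal{Q}_{\mathcal{P}}$-coresolution (i.e. one of some length $n$), and $(\mathcal{P},\mathcal{Q})^{\vee}:=\mathcal{P}\cap\mathcal{Q}_{\mathcal{P}}^{\vee}$. When $\mathcal{P}=\mathcal{C}$ the symbol $\mathcal{P}$ is omitted; in particular $\omega^{\vee}=\omega_{\mathcal{C}}^{\vee}$. *)

(* Defs.v *)
From Stdlib Require Import Relations.
From mathcomp Require Import all_boot all_algebra.

Set Implicit Arguments.
Unset Strict Implicit.
Unset Printing Implicit Defensive.

Import GRing.Theory.
Local Open Scope ring_scope.

Reserved Notation "g \oc f" (at level 40, left associativity).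

Record preadditiveCat := PreadditiveCat {
  ob :> Type;
  mor : ob -> ob -> zmodType;
  idmor : forall A : ob, mor A A;
  compm : forall A B D : ob, mor B D -> mor A B -> mor A D;
  compmA : forall (A B D E : ob) (h : mor D E) (g : mor B D) (f : mor A B),
    compm h (compm g f) = compm (compm h g) f;
  comp1m : forall (A B : ob) (f : mor A B), compm (idmor B) f = f;
  compm1 : forall (A B : ob) (f : mor A B), compm f (idmor A) = f;
  compmDl : forall (A B D : ob) (g g' : mor B D) (f : mor A B),
    compm (g + g') f = compm g f + compm g' f;
  compmDr : forall (A B D : ob) (g : mor B D) (f f' : mor A B),
    compm g (f + f') = compm g f + compm g f'
}.

Arguments mor {p} A B : rename.
Arguments idmor {p} A : rename.
Arguments compm {p A B D} g f : rename.

Notation "g \oc f" := (compm g f).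

Section Preadditive.
Variable C : preadditiveCat.

Definition is_mono (A B : C) (f : mor A B) : Prop :=
  forall (X : C) (x y : mor X A), f \oc x = f \oc y -> x = y.

Definition is_epi (A B : C) (f : mor A B) : Prop :=
  forall (X : C) (x y : mor B X), x \oc f = y \oc f -> x = y.

Definition is_kernel (K A B : C) (f : mor A B) (k : mor K A) : Prop :=
  f \oc k = 0 /\
  forall (X : C) (x : mor X A), f \oc x = 0 -> exists! y : mor X K, k \oc y = x.

Definition is_cokernel (A B Q : C) (f : mor A B) (q : mor B Q) : Prop :=
  q \oc f = 0 /\
  forall (X : C) (x : mor B X), x \oc f = 0 -> exists! y : mor Q X, y \oc q = x.

(* Both initial and terminal. *)
Definition is_zero (Z : C) : Prop :=
  forall X : C, (forall f : mor X Z, f = 0) /\ (forall f : mor Z X, f = 0).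

Definition is_biproduct (A B S : C) (iA : mor A S) (iB : mor B S)
    (pA : mor S A) (pB : mor S B) : Prop :=
  [/\ pA \oc iA = idmor A, pB \oc iB = idmor B, pA \oc iB = 0, pB \oc iA = 0
    & iA \oc pA + iB \oc pB = idmor S].

End Preadditive.

(* Kernels and cokernels are chosen, so that the image of a morphism is an
   object; it is of course only determined up to isomorphism. *)
Record abelianCat := AbelianCat {
  abcat :> preadditiveCat;
  zero_ob : abcat;
  zero_obP : is_zero zero_ob;
  biproductP : forall A B : abcat,
    exists (S : abcat) (iA : mor A S) (iB : mor B S)
           (pA : mor S A) (pB : mor S B), is_biproduct iA iB pA pB;
  ker_ob : forall A B : abcat, mor A B -> abcat;
  kerm : forall (A B : abcat) (f : mor A B), mor (ker_ob f) A;
  kermP : forall (A B : abcat) (f : mor A B), is_kernel f (kerm f);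
  coker_ob : forall A B : abcat, mor A B -> abcat;
  cokerm : forall (A B : abcat) (f : mor A B), mor B (coker_ob f);
  cokermP : forall (A B : abcat) (f : mor A B), is_cokernel f (cokerm f);
  mono_normal : forall (A B : abcat) (f : mor A B), is_mono f ->
    exists (D : abcat) (g : mor B D), is_kernel g f;
  epi_normal : forall (A B : abcat) (f : mor A B), is_epi f ->
    exists (D : abcat) (g : mor D A), is_cokernel g f
}.

Arguments zero_ob {a} : rename.
Arguments ker_ob {a A B} f : rename.
Arguments kerm {a A B} f : rename.
Arguments coker_ob {a A B} f : rename.
Arguments cokerm {a A B} f : rename.

Section Abelian.
Variable C : abelianCat.

Definition im (A B : C) (f : mor A B) : C := ker_ob (cokerm f).
Definition imm (A B : C) (f : mor A B) : mor (im f) B := kerm (cokerm f).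

(* Exactness at B of A -f-> B -g-> D: Im f = Ker g as subobjects of B. *)
Definition exact (A B D : C) (f : mor A B) (g : mor B D) : Prop :=
  is_kernel g (imm f).

Definition short_exact (A B D : C) (f : mor A B) (g : mor B D) : Prop :=
  [/\ is_mono f, exact f g & is_epi g].

(* [aug M X] is the sequence M, X 0, X 1, ...; a long sequence of morphisms
   starting at M is thus a family [f i : mor (aug M X i) (X i)], with
   [f 0 : M -> X 0] and [f i.+1 : X i -> X i.+1] by conversion. *)
Definition aug (M : C) (X : nat -> C) (i : nat) : C :=
  if i is j.+1 then X j else M.

(* Exact sequences 0 -> A -> X 0 -> ... -> X n -> D -> 0: the length, i.e. the
   degree of the class in Ext(D, A), is n.+1. The values of [ext_ob] and
   [ext_map] beyond n are irrelevant. *)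
Record extension (n : nat) (D A : C) := Extension {
  ext_ob : nat -> C;
  ext_map : forall i : nat, mor (aug A ext_ob i) (ext_ob i);
  ext_end : mor (ext_ob n) D;
  ext_mono : is_mono (ext_map 0%N);
  ext_exact : forall i : nat, (i < n)%N -> exact (ext_map i) (ext_map i.+1);
  ext_exact_end : exact (ext_map n) ext_end;
  ext_epi : is_epi ext_end
}.

Definition ext_morphism (n : nat) (D A : C) (E E' : extension n D A) : Prop :=
  exists phi : forall i : nat, mor (ext_ob E i) (ext_ob E' i),
    [/\ phi 0%N \oc ext_map E 0%N = ext_map E' 0%N,
        forall i : nat, (i < n)%N ->
          phi i.+1 \oc ext_map E i.+1 = ext_map E' i.+1 \oc phi i
      & ext_end E' \oc phi n = ext_end E].

(* Ext^{n.+1}(D, A) is the set of extensions modulo this equivalence. *)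
Definition yoneda_equiv (n : nat) (D A : C) : relation (extension n D A) :=
  clos_refl_sym_trans (extension n D A) (@ext_morphism n D A).

(* The group Ext^{n.+1}(D, A) is zero iff it has only one element. *)
Definition ext_vanishes (n : nat) (D A : C) : Prop :=
  forall E E' : extension n D A, yoneda_equiv E E'.

Definition left_perp (U : C -> Prop) (M : C) : Prop :=
  forall X : C, U X -> forall n : nat, ext_vanishes n M X.

Definition extension_closed (U : C -> Prop) : Prop :=
  forall (A B D : C) (f : mor A B) (g : mor B D),
    short_exact f g -> U A -> U D -> U B.

Definition relative_generator (W U : C -> Prop) : Prop :=
  (forall X : C, W X -> U X) /\
  forall X : C, U X -> exists (X' Y : C) (f : mor X' Y) (g : mor Y X),
    [/\ short_exact f g, W Y & U X'].

Definition precover (Zc : C -> Prop) (Z M : C) (f : mor Z M) : Prop :=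
  Zc Z /\ forall Z' : C, Zc Z' ->
    forall h : mor Z' M, exists h' : mor Z' Z, f \oc h' = h.

Definition preenvelope (Zc : C -> Prop) (M Z : C) (g : mor M Z) : Prop :=
  Zc Z /\ forall Z' : C, Zc Z' ->
    forall h : mor M Z', exists h' : mor Z Z', h' \oc g = h.

(* Q_P-coresolutions 0 -> M -> X 0 -> ... -> X n -> 0 of length n. *)
Definition has_coresolution (P Q : C -> Prop) (M : C) (n : nat) : Prop :=
  exists (X : nat -> C) (f : forall i : nat, mor (aug M X i) (X i)),
    [/\ is_mono (f 0%N),
        forall i : nat, (i < n)%N -> exact (f i) (f i.+1)
      & is_epi (f n)] /\
    [/\ P (X n) /\ Q (X n),
        forall k : nat, (k < n)%N -> Q (X k)
      & forall i : nat, (0 < i < n)%N -> P (im (f i))].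

Definition coresdim_is (P Q : C -> Prop) (M : C) (n : nat) : Prop :=
  has_coresolution P Q M n /\
  forall m : nat, has_coresolution P Q M m -> (n <= m)%N.

Definition vee_in (P Q : C -> Prop) (M : C) : Prop :=
  exists n : nat, has_coresolution P Q M n.

Definition pair_vee (P Q : C -> Prop) (M : C) : Prop := P M /\ vee_in P Q M.

Definition vee (Q : C -> Prop) (M : C) : Prop := vee_in (fun _ => True) Q M.

(* The two short exact sequences attached to an object Z with
   coresdim_U^V(Z) = n. *)
Definition envelope_seq (U V W : C -> Prop) (Z : C) (n : nat)
    (MZ CZ : C) (g : mor Z MZ) (p : mor MZ CZ) : Prop :=
  [/\ short_exact g p, pair_vee V W CZ, U MZ
    & if n is m.+1 then coresdim_is V W CZ m else is_zero CZ].

Definition cover_seq (U V W : C -> Prop) (Z : C) (n : nat)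
    (KZ BZ : C) (k : mor KZ BZ) (f : mor BZ Z) : Prop :=
  [/\ short_exact k f, vee_in V W BZ, U KZ
    & exists2 m : nat, coresdim_is V W BZ m & (m <= n)%N].

End Abelian.

(* Main.v *)
Require Import Defs.
From Stdlib Require Import Relations Classical.
From mathcomp Require Import all_boot all_algebra.

(* Part (a) is an induction on the length of the coresolution
   0 -> Z -> Q -> Z' -> 0: pulling a cover B' of Z' back along Q -> Z' gives the
   envelope 0 -> Z -> M -> B' -> 0, and pulling a relative-generator cover of M
   back along Z -> M gives the cover of Z.

   Part (c) rests on dimension shifting for Yoneda Ext. To handle the zigzags
   in the equivalence of extensions, vanishing of the class of E pulled back
   along h : L -> D is expressed by a lift to E of a resolution of L
   ([triv_along]), built from the right one epimorphism at a time. This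
   condition is additive in h and both preserved and reflected by morphisms of
   extensions, hence invariant under Yoneda equivalence. Conversely, classes
   that agree on a pullback are glued explicitly ([glue]); this shows both that
   the condition implies equivalence with the split extension, and that for
   0 -> X -> Y -> D -> 0 a class in Ext^i(X, A) comes from Ext^i(Y, A) as soon
   as Ext^{i+1}(D, A) = 0. Diagrams are chased with generalized elements, lifted
   along epimorphisms ([exactP]). *)

Set Implicit Arguments.
Unset Strict Implicit.
Unset Printing Implicit Defensive.

Import GRing.Theory.
Local Open Scope ring_scope.

(** * Kernels, cokernels and pullbacks in a preadditive category *)

Section PreadditiveTheory.
Variable C : preadditiveCat.
Implicit Types A B D K : C.

Lemma comp0m A B D (f : mor A B) : (0 : mor B D) \oc f = 0.
Proof. by apply: (addrI (0 \oc f)); rewrite -compmDl !addr0. Qed.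

Lemma compm0 A B D (g : mor B D) : g \oc (0 : mor A B) = 0.
Proof. by apply: (addrI (g \oc 0)); rewrite -compmDr !addr0. Qed.

Lemma compNm A B D (g : mor B D) (f : mor A B) : (- g) \oc f = - (g \oc f).
Proof. by apply: (addrI (g \oc f)); rewrite -compmDl !subrr comp0m. Qed.

Lemma compmN A B D (g : mor B D) (f : mor A B) : g \oc (- f) = - (g \oc f).
Proof. by apply: (addrI (g \oc f)); rewrite -compmDr !subrr compm0. Qed.

Lemma compmBl A B D (g g' : mor B D) (f : mor A B) :
  (g - g') \oc f = g \oc f - g' \oc f.
Proof. by rewrite compmDl compNm. Qed.

Lemma compmBr A B D (g : mor B D) (f f' : mor A B) :
  g \oc (f - f') = g \oc f - g \oc f'.
Proof. by rewrite compmDr compmN. Qed.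

Lemma monoP A B (f : mor A B) :
  is_mono f <-> forall (X : C) (x : mor X A), f \oc x = 0 -> x = 0.
Proof.
split=> [fm X x fx0|f0 X x y fxy]; first by apply: fm; rewrite fx0 compm0.
by apply/eqP; rewrite -subr_eq0; apply/eqP/f0; rewrite compmBr fxy subrr.
Qed.

Lemma epiP A B (f : mor A B) :
  is_epi f <-> forall (X : C) (x : mor B X), x \oc f = 0 -> x = 0.
Proof.
split=> [fm X x fx0|f0 X x y fxy]; first by apply: fm; rewrite fx0 comp0m.
by apply/eqP; rewrite -subr_eq0; apply/eqP/f0; rewrite compmBl fxy subrr.
Qed.

Lemma idm_mono A : is_mono (idmor A).
Proof. by move=> T x y; rewrite !comp1m. Qed.

Lemma idm_epi A : is_epi (idmor A).
Proof. by move=> X x y; rewrite !compm1. Qed.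

Lemma epi_comp A B D (g : mor B D) (f : mor A B) :
  is_epi g -> is_epi f -> is_epi (g \oc f).
Proof. by move=> ge fe X x y; rewrite !compmA => /fe /ge. Qed.

Lemma epi_of_comp A B D (g : mor B D) (f : mor A B) :
  is_epi (g \oc f) -> is_epi g.
Proof. by move=> gfe X x y xy; apply: gfe; rewrite !compmA xy. Qed.

Lemma mono_comp A B D (g : mor B D) (f : mor A B) :
  is_mono g -> is_mono f -> is_mono (g \oc f).
Proof. by move=> gm fm X x y; rewrite -!compmA => /gm /fm. Qed.

Lemma mono_of_comp A B D (g : mor B D) (f : mor A B) :
  is_mono (g \oc f) -> is_mono f.
Proof. by move=> gfm X x y xy; apply: gfm; rewrite -!compmA xy. Qed.

Lemma kernelP K A B (f : mor A B) (k : mor K A) :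
  is_kernel f k <-> [/\ f \oc k = 0, is_mono k
    & forall (X : C) (x : mor X A), f \oc x = 0 -> exists y, k \oc y = x].
Proof.
split=> [[fk kP]|[fk km kP]].
  split=> // [X x y kxy|X x /kP[y [kyx _]]]; last by exists y.
  have [|z [_ zP]] := kP X (k \oc x); first by rewrite compmA fk comp0m.
  by rewrite -(zP x erefl) -(zP y (esym kxy)).
split=> // X x /kP[y kyx]; exists y; split=> // y' ky'x.
by apply: km; rewrite kyx.
Qed.

Lemma cokernelP A B Q (f : mor A B) (q : mor B Q) :
  is_cokernel f q <-> [/\ q \oc f = 0, is_epi q
    & forall (X : C) (x : mor B X), x \oc f = 0 -> exists y, y \oc q = x].
Proof.
split=> [[qf qP]|[qf qe qP]].
  split=> // [X x y xyq|X x /qP[y [yqx _]]]; last by exists y.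
  have [|z [_ zP]] := qP X (x \oc q); first by rewrite -compmA qf compm0.
  by rewrite -(zP x erefl) -(zP y (esym xyq)).
split=> // X x /qP[y yqx]; exists y; split=> // y' y'qx.
by apply: qe; rewrite yqx.
Qed.

(** Uniqueness of the induced morphism is stated as a test on zero, which suffices by additivity. *)
Definition is_pullback (M X Z Y : C) (m : mor M X) (c : mor M Z)
    (j : mor X Y) (d : mor Z Y) : Prop :=
  [/\ j \oc m = d \oc c,
      forall (T : C) (x : mor T X) (z : mor T Z), j \oc x = d \oc z ->
        exists t : mor T M, m \oc t = x /\ c \oc t = z
    & forall (T : C) (t : mor T M), m \oc t = 0 -> c \oc t = 0 -> t = 0].

(** Epimorphy of the induced morphism from a biproduct of [X] and [Z] to [Y], without choosing a
    biproduct. *)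
Definition jointly_epi (X Z Y : C) (j : mor X Y) (d : mor Z Y) : Prop :=
  forall (T : C) (t : mor Y T), t \oc j = 0 -> t \oc d = 0 -> t = 0.

Lemma pullback_sym M X Z Y (m : mor M X) (c : mor M Z)
    (j : mor X Y) (d : mor Z Y) :
  is_pullback m c j d -> is_pullback c m d j.
Proof.
case=> jd pb jm; split=> // [T x z dj|T t c0 m0]; last exact: jm.
by have [//|t [mt ct]] := pb T z x; exists t.
Qed.

(** The kernel [k] of [d] lifts to the pullback when paired with the zero morphism to [X]. *)
Lemma pullback_ker M X Z Y (m : mor M X) (c : mor M Z)
    (j : mor X Y) (d : mor Z Y) K (k : mor K Z) :
  is_pullback m c j d -> is_kernel d k ->
  exists2 k' : mor K M, is_kernel m k' & c \oc k' = k.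
Proof.
case=> jd pb jm /kernelP[dk km kP].
have [|k' [mk' ck']] := pb K 0 k; first by rewrite compm0 dk.
exists k' => //; apply/kernelP; split=> //.
  by apply: (@mono_of_comp _ _ _ c); rewrite ck'.
move=> T x mx; have [|y ky] := kP T (c \oc x).
  by rewrite compmA -jd -compmA mx compm0.
exists y; apply/eqP; rewrite -subr_eq0; apply/eqP; apply: jm.
  by rewrite compmBr compmA mk' comp0m mx subrr.
by rewrite compmBr compmA ck' ky subrr.
Qed.

Lemma pullback_of_kernel M X Z Y (m : mor M X) (c : mor M Z)
    (j : mor X Y) (d : mor Z Y) Q (p : mor Y Q) :
  is_pullback m c j d -> is_kernel p d -> is_kernel (p \oc j) m.
Proof.
case=> jd pb jm /kernelP[pd dm dP]; apply/kernelP; split.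
- by rewrite -compmA jd compmA pd comp0m.
- apply/monoP => T x mx; apply: jm => //; apply: dm.
  by rewrite compmA -jd -compmA mx !compm0.
move=> T x; rewrite -compmA => /dP[z dz].
by have [//|t [mt _]] := pb T x z; exists t.
Qed.

End PreadditiveTheory.

(** * Factorizations, pullbacks of epimorphisms and exactness in an abelian category *)

Section AbelianTheory.
Variable C : abelianCat.
Implicit Types A B D K : C.

Lemma kerm0 A B (f : mor A B) : f \oc kerm f = 0.
Proof. by have [] := kermP f. Qed.

Lemma kerm_mono A B (f : mor A B) : is_mono (kerm f).
Proof. by have /kernelP[] := kermP f. Qed.

Lemma kerm_lift A B (f : mor A B) T (x : mor T A) :
  f \oc x = 0 -> exists y, kerm f \oc y = x.
Proof. by have /kernelP[_ _] := kermP f; apply. Qed.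

Lemma kerm_id A : kerm (idmor A) = 0.
Proof. by rewrite -[LHS]comp1m kerm0. Qed.

Lemma cokerm0 A B (f : mor A B) : cokerm f \oc f = 0.
Proof. by have [] := cokermP f. Qed.

Lemma cokerm_epi A B (f : mor A B) : is_epi (cokerm f).
Proof. by have /cokernelP[] := cokermP f. Qed.

(** An epimorphism is the cokernel of some [g]; as [g] factors through the kernel [k], whatever
    kills [k] kills [g]. *)
Lemma epi_desc A B K (f : mor A B) (k : mor K A) T (x : mor A T) :
  is_epi f -> is_kernel f k -> x \oc k = 0 -> exists y, y \oc f = x.
Proof.
move=> fe /kernelP[_ _ kP] xk.
have [D [g /cokernelP[fg _ gP]]] := epi_normal fe.
have [g' kg] := kP _ _ fg.
by apply: gP; rewrite -kg compmA xk comp0m.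
Qed.

(** If [x] kills [e], then [f] factors through the kernel of [x], a subobject of the image. Inside
    [B] this subobject is the kernel of some [g]; since [g] kills [f], it kills the image, so the
    kernel of [x] is the whole image and [x] vanishes. *)
Lemma im_epi A B (f : mor A B) :
  exists2 e : mor A (im f), is_epi e & imm f \oc e = f.
Proof.
have [e fe] := kerm_lift (cokerm0 f).
exists e => //; apply/epiP => T x xe.
have [e' ke'] := kerm_lift xe.
have ikm := mono_comp (@kerm_mono _ _ (cokerm f)) (@kerm_mono _ _ x).
have [D [g /kernelP[gik _ gP]]] := mono_normal ikm.
have /cokernelP[_ _ /(_ D g)] := cokermP f.
case=> [|g' gg']; first by rewrite -fe -ke' !compmA -(compmA g) gik !comp0m.
have [|t it] := gP _ (kerm (cokerm f)).
  by rewrite -gg' -compmA kerm0 compm0.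
have kt : kerm x \oc t = idmor _.
  by apply: (@kerm_mono _ _ (cokerm f)); rewrite compmA it compm1.
by rewrite -[x]compm1 -kt compmA kerm0 comp0m.
Qed.

Lemma pullback_exists (X Z Y : C) (j : mor X Y) (d : mor Z Y) :
  exists (M : C) (m : mor M X) (c : mor M Z), is_pullback m c j d.
Proof.
have [S [iX [iZ [pX [pZ [piX piZ pXZ pZX pS]]]]]] := biproductP X Z.
pose k := kerm (j \oc pX - d \oc pZ).
exists _, (pX \oc k), (pZ \oc k); split.
- apply/eqP; rewrite -subr_eq0 !compmA -compmBl; apply/eqP; exact: kerm0.
- move=> T x z jxz.
  have [|t kt] := @kerm_lift _ _ (j \oc pX - d \oc pZ) T (iX \oc x + iZ \oc z).
    rewrite compmBl !compmDr !compmA -!(compmA _ pX) -!(compmA _ pZ).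
    by rewrite piX piZ pXZ pZX !compm0 !comp0m !compm1 addr0 add0r jxz subrr.
  exists t; rewrite -!compmA kt !compmDr !compmA piX piZ pXZ pZX.
  by rewrite !comp0m !comp1m addr0 add0r.
move=> T t mt ct; apply: (@kerm_mono _ _ (j \oc pX - d \oc pZ)).
rewrite compm0 -[LHS]comp1m -pS compmDl -!compmA.
by rewrite (compmA pX) (compmA pZ) mt ct !compm0 addr0.
Qed.

(** [phi] is epi because [d] is, hence it is the cokernel of its kernel, and that kernel factors
    through the pullback. So a morphism [x] killing [m] gives [x \oc pX = y \oc phi]; restricting to
    [Z] gives [y \oc d = 0]. *)
Lemma pullback_epi (M X Z Y : C) (m : mor M X) (c : mor M Z)
    (j : mor X Y) (d : mor Z Y) :
  is_pullback m c j d -> is_epi d -> is_epi m.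
Proof.
case=> jd pb jm de.
have [S [iX [iZ [pX [pZ [piX piZ pXZ pZX pS]]]]]] := biproductP X Z.
pose phi := j \oc pX - d \oc pZ.
have phiZ : phi \oc iZ = - d.
  by rewrite compmBl -!compmA pXZ piZ compm0 compm1 sub0r.
have phie : is_epi phi.
  apply: (@epi_of_comp _ _ _ _ _ (- iZ)).
  by rewrite compmN phiZ opprK.
apply/epiP => T x xm.
have [|y yphi] := epi_desc (x := x \oc pX) phie (kermP phi).
  have [|t [mt _]] := pb _ (pX \oc kerm phi) (pZ \oc kerm phi).
    apply/eqP; rewrite -subr_eq0 !compmA -compmBl; apply/eqP; exact: kerm0.
  by rewrite -compmA -mt compmA xm comp0m.
have y0 : y = 0.
  apply: de; rewrite comp0m; apply: oppr_inj.
  by rewrite oppr0 -compmN -phiZ compmA yphi -compmA pXZ compm0.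
by rewrite -[x]compm1 -piX compmA -yphi y0 !comp0m.
Qed.

Lemma epi_lift A B (f : mor A B) T (b : mor T B) : is_epi f ->
  exists (T' : C) (e : mor T' T) (a : mor T' A), is_epi e /\ f \oc a = b \oc e.
Proof.
move=> fe; have [M [e [a pb]]] := pullback_exists b f.
exists M, e, a; split; first exact: pullback_epi pb fe.
by case: pb => ->.
Qed.

Lemma exactP A B D (f : mor A B) (g : mor B D) :
  exact f g <-> g \oc f = 0 /\
  forall (T : C) (b : mor T B), g \oc b = 0 ->
    exists (T' : C) (e : mor T' T) (a : mor T' A),
      is_epi e /\ f \oc a = b \oc e.
Proof.
have [e ee fe] := im_epi f; split=> [/kernelP[gi _ iP]|[gf fP]].
  split=> [|T b /iP[b' <-]]; first by rewrite -fe compmA gi comp0m.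
  have [T' [e' [a [e'e ea]]]] := epi_lift b' ee.
  by exists T', e', a; split=> //; rewrite -{1}fe -!compmA ea.
apply/kernelP; split; first by apply: ee; rewrite -compmA fe gf comp0m.
  exact: kerm_mono.
move=> T b /fP[T' [e' [a [e'e fa]]]]; apply: kerm_lift.
by apply: e'e; rewrite -compmA -fa compmA cokerm0 !comp0m.
Qed.

Lemma sesP A B D (f : mor A B) (g : mor B D) :
  short_exact f g <-> is_kernel g f /\ is_epi g.
Proof.
split=> [[fm /exactP[gf fP] ge]|[/kernelP[gf fm fP] ge]].
  split=> //; apply/kernelP; split=> // T b /fP[T' [e [a [ee fa]]]].
  have [|y ye] := epi_desc (x := a) ee (kermP e).
    by apply: fm; rewrite compmA fa -compmA kerm0 !compm0.
  by exists y; apply: ee; rewrite -compmA ye.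
split=> //; apply/exactP; split=> // T b /fP[a fa].
by exists T, (idmor T), a; split; [exact: idm_epi | rewrite compm1].
Qed.

(** Since [im] is a chosen object, the image of [g \oc p] is [B] only up to isomorphism, expressed
    here by a morphism that is mono and epi. *)
Lemma im_mono_epi A B D (g : mor B D) (p : mor A B) :
  is_mono g -> is_epi p ->
  exists2 u : mor B (im (g \oc p)), is_mono u & is_epi u.
Proof.
move=> gm pe; have [e ee ie] := im_epi (g \oc p).
have [|u iu] := @kerm_lift _ _ (cokerm (g \oc p)) _ g.
  by apply: pe; rewrite -compmA cokerm0 comp0m.
exists u; first by apply: (@mono_of_comp _ _ _ _ (imm (g \oc p))); rewrite iu.
apply: (@epi_of_comp _ _ _ _ _ p); suff -> : u \oc p = e by [].
by apply: (@kerm_mono _ _ (cokerm (g \oc p))); rewrite compmA iu.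
Qed.

End AbelianTheory.

(** * Trivial pullbacks of an exact sequence *)

Section PullbackTriviality.
Variable C : abelianCat.
Implicit Types A B D K L : C.

(* If [0 -> A -> X 0 -> ... -> X n -> q(X n) -> 0] is exact and [h] factors
   through the image of [q], this says that the pullback of that extension
   along [h] has trivial class. *)
Fixpoint triv_along A (X : nat -> C) (f : forall i, mor (aug A X i) (X i))
    (n : nat) B : mor (X n) B -> forall L, mor L B -> Prop :=
  match n with
  | 0 => fun q L h => exists s : mor L (X 0%N), q \oc s = h
  | n'.+1 => fun q L h =>
      exists (Z : C) (z : mor Z L) (y : mor Z (X n'.+1)),
        [/\ is_epi z, q \oc y = h \oc z
          & @triv_along A X f n' (X n'.+1) (f n'.+1) (ker_ob z) (y \oc kerm z)]
  end.

Section OneSequence.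
Variables (A : C) (X : nat -> C) (f : forall i, mor (aug A X i) (X i)).
Local Notation triv := (triv_along f).

(** Pulling the covering [z] back along [a] gives a covering of [L'] whose kernel maps to that of
    [z], where the induction applies. *)
Lemma triv_comp n B (q : mor (X n) B) L (h : mor L B) L' (a : mor L' L) :
  triv q h -> triv q (h \oc a).
Proof.
elim: n B q L h L' a => [|n IHn] B q L h L' a /=.
  by case=> s qs; exists (s \oc a); rewrite compmA qs.
case=> Z [z [y [ze qy ty]]].
have [Z' [z' [p pb]]] := pullback_exists a z.
have [az _ _] := pb.
exists Z', z', (y \oc p); split; first exact: pullback_epi pb ze.
  by rewrite compmA qy -!compmA az.
have [|k kz] := @kerm_lift _ _ _ z _ (p \oc kerm z').
  by rewrite compmA -az -compmA kerm0 compm0.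
by rewrite -compmA -kz compmA; apply: IHn.
Qed.

(** Both trivializations are restricted to the common covering [P]; its kernel over [L] maps to the
    kernels of [z] and [z']. *)
Lemma triv_sub n B (q : mor (X n) B) L (h h' : mor L B) :
  triv q h -> triv q h' -> triv q (h - h').
Proof.
elim: n B q L h h' => [|n IHn] B q L h h' /=.
  by case=> s qs [s' qs']; exists (s - s'); rewrite compmBr qs qs'.
case=> Z [z [y [ze qy ty]]] [Z' [z' [y' [z'e qy' ty']]]].
have [P [p [p' pb]]] := pullback_exists z z'.
have [zp _ _] := pb.
exists P, (z \oc p), (y \oc p - y' \oc p'); split.
- by apply: epi_comp => //; apply: pullback_epi pb z'e.
- by rewrite compmBr compmBl !compmA qy qy' -(compmA h') -zp compmA.
have [|k kz] := @kerm_lift _ _ _ z _ (p \oc kerm (z \oc p)).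
  by rewrite compmA kerm0.
have [|k' kz'] := @kerm_lift _ _ _ z' _ (p' \oc kerm (z \oc p)).
  by rewrite compmA -zp kerm0.
rewrite compmBl -!compmA -kz -kz' !compmA.
by apply: IHn; apply: triv_comp.
Qed.

(** [L] covers itself by the identity; the next morphism to be treated is zero, which lifts to
    zero. *)
Lemma triv_lift n B (q : mor (X n) B) L (s : mor L (X n)) : triv q (q \oc s).
Proof.
elim: n B q L s => [|n IHn] B q L s /=; first by exists s.
exists L, (idmor L), s; split; [exact: idm_epi | by rewrite compm1 |].
by rewrite kerm_id compm0 -(compm0 _ (f n.+1)); apply: IHn.
Qed.

Lemma triv_add n B (q : mor (X n) B) L (h h' : mor L B) :
  triv q h -> triv q h' -> triv q (h + h').
Proof.
move=> th th'; rewrite -[h']opprK -[- h']sub0r; apply: triv_sub => //.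
by apply: triv_sub => //; rewrite -(compm0 _ q); apply: triv_lift.
Qed.

Lemma triv_mono n B B' (q : mor (X n) B) (i : mor B B') L (h : mor L B) :
  is_mono i -> triv (i \oc q) (i \oc h) -> triv q h.
Proof.
move=> im; case: n q => [|n] q /=.
  by case=> s qs; exists s; apply: im; rewrite compmA.
case=> Z [z [y [ze qy ty]]]; exists Z, z, y; split=> //.
by apply: im; rewrite !compmA.
Qed.

End OneSequence.

Section TwoSequences.
Variables (A : C) (X X' : nat -> C).
Variables (f : forall i, mor (aug A X i) (X i)).
Variables (f' : forall i, mor (aug A X' i) (X' i)).
Variable (phi : forall i, mor (X i) (X' i)).

Lemma triv_push n B B' (q : mor (X n) B) (q' : mor (X' n) B') (b : mor B B')
    L (h : mor L B) :
  (forall i, (i < n)%N -> phi i.+1 \oc f i.+1 = f' i.+1 \oc phi i) ->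
  q' \oc phi n = b \oc q -> triv_along f q h -> triv_along f' q' (b \oc h).
Proof.
elim: n B B' q q' b L h => [|n IHn] B B' q q' b L h phif qphi /=.
  by case=> s qs; exists (phi 0%N \oc s); rewrite compmA qphi -compmA qs.
case=> Z [z [y [ze qy ty]]]; exists Z, z, (phi n.+1 \oc y); split=> //.
  by rewrite compmA qphi -compmA qy compmA.
rewrite -compmA; apply: IHn ty; last by rewrite phif.
by move=> i ilt; apply: phif; apply: ltnW.
Qed.

(** After a covering, [h] lifts to [X n], and the image of this lift under [phi] differs from the
    given lift to [X' n] by an element of the image of [f']. For [n > 0] this difference does not
    affect triviality on the kernel of the covering; for [n = 0] it is removed by modifying the
    lift, which then descends to [L] because [f' 0] is mono. *)
Lemma triv_reflect n B B' (q : mor (X n) B) (q' : mor (X' n) B')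
    (b : mor B B') L (h : mor L B) :
  is_mono (f 0%N) -> is_mono (f' 0%N) -> phi 0%N \oc f 0%N = f' 0%N ->
  (forall i, (i < n)%N -> exact (f i) (f i.+1)) -> exact (f n) q ->
  (forall i, (i < n)%N -> exact (f' i) (f' i.+1)) -> exact (f' n) q' ->
  (forall i, (i < n)%N -> phi i.+1 \oc f i.+1 = f' i.+1 \oc phi i) ->
  q' \oc phi n = b \oc q ->
  (exists (T : C) (e : mor T L) (a : mor T (X n)),
    is_epi e /\ q \oc a = h \oc e) ->
  triv_along f' q' (b \oc h) -> triv_along f q h.
Proof.
move=> fm f'm phi0.
elim: n B B' q q' b L h => [|n IHn] B B' q q' b L h fex qex f'ex q'ex phif qphi.
  move=> [T [e [y [ee qy]]]] /= [s' qs'].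
  have /exactP[qf qP] := qex; have /exactP[qf' qP'] := q'ex.
  have [|T2 [e2 [a [e2e fa]]]] := qP' _ (phi 0%N \oc y - s' \oc e).
    by rewrite compmBr !compmA qphi qs' -!compmA qy subrr.
  pose s := y \oc e2 - f 0%N \oc a.
  have qs : q \oc s = h \oc (e \oc e2).
    by rewrite compmBr compmA qy (compmA q) qf comp0m subr0 compmA.
  have phis : phi 0%N \oc s = s' \oc (e \oc e2).
    rewrite compmBr (compmA _ (f 0%N)) phi0 fa compmBl !compmA.
    by rewrite opprB addrCA subrr addr0.
  have ee2 := epi_comp ee e2e.
  have [|t ts] := epi_desc (x := s) ee2 (kermP (e \oc e2)); last first.
    by exists t; apply: ee2; rewrite -compmA ts.
  have [|T3 [e3 [c [e3e fc]]]] := qP _ (s \oc kerm (e \oc e2)).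
    by rewrite compmA qs -compmA kerm0 compm0.
  have c0 : c = 0.
    apply: f'm; rewrite compm0 -phi0 -compmA fc !compmA phis.
    by rewrite -(compmA s') kerm0 compm0 comp0m.
  by apply: e3e; rewrite -fc c0 compm0 comp0m.
move=> [T [e [y [ee qy]]]] /= [Z' [z' [y' [z'e qy' ty']]]].
have /exactP[qf qP] := qex; have /exactP[qf' qP'] := q'ex.
have [Z [p [r pb]]] := pullback_exists z' e.
have pe := pullback_epi pb ee; have [zp _ _] := pb.
have [|Z2 [e2 [a [e2e fa]]]] := qP' _ (phi n.+1 \oc (y \oc r) - y' \oc p).
  rewrite compmBr !compmA qphi qy' -!compmA zp !compmA.
  by rewrite -(compmA b q) qy !compmA subrr.
pose z := z' \oc p \oc e2.
have qz : q \oc (y \oc r \oc e2) = h \oc z by rewrite /z zp !compmA qy.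
exists Z2, z, (y \oc r \oc e2); split=> //.
  by apply: epi_comp => //; apply: epi_comp.
have yz0 : q \oc (y \oc r \oc e2 \oc kerm z) = 0.
  by rewrite compmA qz -compmA kerm0 compm0.
apply: (IHn _ _ (f n.+1) (f' n.+1) (phi n.+1)).
- by move=> i ilt; apply: fex; apply: ltnW.
- exact: fex.
- by move=> i ilt; apply: f'ex; apply: ltnW.
- exact: f'ex.
- by move=> i ilt; apply: phif; apply: ltnW.
- by rewrite phif.
- exact: qP yz0.
have [|k kz] := @kerm_lift _ _ _ z' _ (p \oc e2 \oc kerm z).
  by rewrite !compmA kerm0.
have -> : phi n.+1 \oc (y \oc r \oc e2 \oc kerm z) =
    y' \oc kerm z' \oc k + f' n.+1 \oc (a \oc kerm z).
  rewrite -(compmA y') kz (compmA _ a) fa compmBl -!compmA compmBl.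
  by rewrite -!compmA addrC subrK.
by apply: triv_add; [apply: triv_comp | apply: triv_lift].
Qed.

End TwoSequences.
End PullbackTriviality.

(** Confines the transport along an equality of indices that a dependent family needs when one entry
    is changed. *)
Lemma override_at (P : nat -> Type) (f : forall i, P i) (n : nat) (w : P n) :
  exists g : forall i, P i, g n = w /\ forall i, i != n -> g i = f i.
Proof.
exists (fun i => if i =P n is ReflectT e then eq_rect n P w i (esym e) else f i).
split=> [|i]; first by case: eqP => // e; rewrite (eq_irrelevance e erefl).
by case: eqP.
Qed.

(** * Morphisms of extensions over a morphism of end terms, and splicing *)

Section Extensions.
Variable C : abelianCat.
Implicit Types A B D K L : C.

Lemma kernel_exact A B D (f : mor A B) (g : mor B D) :
  is_kernel g f -> exact f g.
Proof.
move=> /kernelP[gf _ fP]; apply/exactP; split=> // T x /fP[y fy].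
by exists T, (idmor T), y; split; [exact: idm_epi | rewrite compm1].
Qed.

(** Precomposition with an epi keeps the image and postcomposition with a mono keeps the kernel;
    this absorbs the comparison morphisms of [splice_right]. *)
Lemma exact_iso A B D (f : mor A B) (g : mor B D) A' (u : mor A' A)
    B' (b : mor B B') (a : mor B' B) D' (m : mor D D') :
  exact f g -> is_epi u -> a \oc b = idmor B -> b \oc a = idmor B' ->
  is_mono m -> exact (b \oc f \oc u) (m \oc g \oc a).
Proof.
move=> /exactP[gf fP] ue ab ba /monoP mm; apply/exactP; split.
  rewrite !compmA -(compmA _ a b) ab compm1 -(compmA m) gf.
  by rewrite compm0 comp0m.
move=> T x; rewrite -!compmA => /mm /fP[T1 [e1 [y [e1e fy]]]].
have [T2 [e2 [y' [e2e uy]]]] := epi_lift y ue.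
exists T2, (e1 \oc e2), y'; split; first exact: epi_comp.
by rewrite -!compmA uy (compmA f) fy !compmA ba comp1m.
Qed.

(** Such a morphism exhibits [E] as representing the pullback of the class of [E'] along [h]. *)
Definition morphism_over n D D' A (E : extension n D A) (E' : extension n D' A)
    (h : mor D D') : Prop :=
  exists phi : forall i, mor (ext_ob E i) (ext_ob E' i),
    [/\ phi 0%N \oc ext_map E 0%N = ext_map E' 0%N,
        forall i, (i < n)%N ->
          phi i.+1 \oc ext_map E i.+1 = ext_map E' i.+1 \oc phi i
      & ext_end E' \oc phi n = h \oc ext_end E].

(** The Yoneda product with 0 -> L -> Z -> D -> 0. The terms of the spliced sequence are defined by
    a test on the index, so they are those of [E], or [Z], only after deciding that test; [a], [b],
    [c] and [d] are the resulting identifications. *)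
Lemma splice_right n L Z D A (E : extension n L A) (l : mor L Z) (z : mor Z D) :
  is_kernel z l -> is_epi z ->
  exists (E' : extension n.+1 D A)
    (a : forall i, mor (ext_ob E' i) (ext_ob E i))
    (b : forall i, mor (ext_ob E i) (ext_ob E' i))
    (c : mor (ext_ob E' n.+1) Z) (d : mor Z (ext_ob E' n.+1)),
    [/\ b 0%N \oc ext_map E 0%N = ext_map E' 0%N,
        forall i, (i < n)%N ->
          b i.+1 \oc ext_map E i.+1 = ext_map E' i.+1 \oc b i,
        a 0%N \oc ext_map E' 0%N = ext_map E 0%N
      & forall i, (i < n)%N ->
          a i.+1 \oc ext_map E' i.+1 = ext_map E i.+1 \oc a i] /\
    [/\ a n \oc b n = idmor _, c \oc d = idmor _,
        ext_map E' n.+1 = d \oc l \oc (ext_end E \oc a n)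
      & ext_end E' = z \oc c].
Proof.
move=> zl ze; case: E => X f e fm fex eex ee /=.
(* At [n.+1] the term of [E] is replaced by [Z]; there [a] and [b] take the default value 0, and
   elsewhere they are identities. *)
pose X' i := if i == n.+1 then Z else X i.
pose a i : mor (X' i) (X i) :=
  if i == n.+1 as t return mor (if t then Z else X i) (X i)
  then 0 else idmor (X i).
pose b i : mor (X i) (X' i) :=
  if i == n.+1 as t return mor (X i) (if t then Z else X i)
  then 0 else idmor (X i).
have ab i : i != n.+1 -> a i \oc b i = idmor (X i).
  by rewrite /a /b /X'; case: (i == n.+1); rewrite //= comp1m.
have ba i : i != n.+1 -> b i \oc a i = idmor (X' i).
  by rewrite /a /b /X'; case: (i == n.+1); rewrite //= comp1m.
have [c [d [cd dc]]] : exists (c : mor (X' n.+1) Z) (d : mor Z (X' n.+1)),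
    c \oc d = idmor Z /\ d \oc c = idmor _.
  by rewrite /X' eqxx; exists (idmor Z), (idmor Z); rewrite !comp1m.
pose aa i : mor (aug A X' i) (aug A X i) := if i is j.+1 then a j else idmor A.
pose w : mor (X' n) (X' n.+1) := d \oc l \oc (e \oc a n).
have [f' [f'n f'E]] := @override_at (fun i => mor (aug A X' i) (X' i))
  (fun i => b i \oc f i \oc aa i) n.+1 w.
have f'lt i : (i <= n)%N -> f' i = b i \oc f i \oc aa i.
  by move=> ilt; apply: f'E; rewrite neq_ltn ltnS ilt.
have nn i : (i <= n)%N -> i != n.+1 by move=> ilt; rewrite neq_ltn ltnS ilt.
have aae i : (i <= n.+1)%N -> is_epi (aa i).
  case: i => [|i] ilt; first exact: idm_epi.
  apply: (@epi_of_comp _ _ _ _ (a i) (b i)); rewrite ab; last exact: nn.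
  exact: idm_epi.
have bm i : (i <= n)%N -> is_mono (b i).
  move=> ilt; apply: (@mono_of_comp _ _ _ _ (a i)); rewrite ab ?nn //.
  exact: idm_mono.
have f'm : is_mono (f' 0%N).
  by rewrite f'lt // compm1; apply: mono_comp => //; apply: bm.
have f'ex i : (i < n.+1)%N -> exact (f' i) (f' i.+1).
  rewrite ltnS leq_eqVlt => /predU1P[->|ilt].
    rewrite f'n f'lt // /w compmA.
    apply: exact_iso => //; rewrite ?ab ?ba ?nn //.
      exact: aae.
    apply: mono_comp; last by case/kernelP: zl.
    by apply: (@mono_of_comp _ _ _ _ c); rewrite cd; apply: idm_mono.
  rewrite f'lt ?(ltnW ilt) // f'lt //.
  apply: exact_iso; rewrite ?ab ?ba ?nn ?(ltnW ilt) //.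
  - exact: fex.
  - by apply: aae; apply/ltnW/ltnW.
  - exact: bm.
have f'z : exact (f' n.+1) (z \oc c).
  rewrite f'n /w -[z]comp1m; apply: exact_iso => //; last exact: idm_mono.
    exact: kernel_exact.
  apply: epi_comp => //; exact: (aae n.+1).
have zce : is_epi (z \oc c).
  apply: epi_comp => //; apply: (@epi_of_comp _ _ _ _ _ d).
  by rewrite cd; apply: idm_epi.
exists (Extension f'm f'ex f'z zce), a, b, c, d; split; split=> //=.
- by rewrite f'lt // compm1.
- by move=> i ilt; rewrite f'lt //= -compmA ab ?compm1 // nn // ltnW.
- by rewrite f'lt // compm1 compmA ab // comp1m.
- by move=> i ilt; rewrite f'lt //= !compmA ab ?comp1m // nn.
- exact/ab/nn.
Qed.

End Extensions.

(** * Split extensions, pushouts and gluing *)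

Section Gluing.
Variable C : abelianCat.
Implicit Types A B D K L : C.

(** In degree one this is a biproduct; in higher degrees, a split extension of the zero object
    spliced with 0 -> 0 -> D = D -> 0. The second clause, a morphism to any complex starting at [A]
    whose last term receives a morphism from [D], is what later links it to extensions having a
    section. *)
Lemma split_extension n D A : exists S : extension n D A,
  (exists s, ext_end S \oc s = idmor D) /\
  forall (X : nat -> C) (f : forall i, mor (aug A X i) (X i)) B
      (q : mor (X n) B) (s : mor D (X n)),
    (forall i, (i < n)%N -> f i.+1 \oc f i = 0) -> q \oc f n = 0 ->
    exists phi : forall i, mor (ext_ob S i) (X i),
    [/\ phi 0%N \oc ext_map S 0%N = f 0%N,
        forall i, (i < n)%N -> phi i.+1 \oc ext_map S i.+1 = f i.+1 \oc phi i
      & q \oc phi n = q \oc s \oc ext_end S].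
Proof.
elim: n D => [|n IHn] D.
  have [S [iA [iD [pA [pD [piA piD pAD pDA pS]]]]]] := biproductP A D.
  have iAk : is_kernel pD iA.
    apply/kernelP; split=> // [|T x pDx].
      by apply: (@mono_of_comp _ _ _ _ pA); rewrite piA; apply: idm_mono.
    exists (pA \oc x).
    by rewrite -[x in RHS]comp1m -pS compmDl -!compmA pDx compm0 addr0.
  have pDe : is_epi pD.
    by apply: (@epi_of_comp _ _ _ _ _ iD); rewrite piD; apply: idm_epi.
  have iAm : is_mono iA by case/kernelP: iAk.
  pose m i : mor (aug A (fun=> S) i) S := if i is _.+1 then 0 else iA.
  have nex i : (i < 0)%N -> exact (m i) (m i.+1) by [].
  exists (@Extension C 0 D A (fun=> S) m pD iAm nex (kernel_exact iAk) pDe).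
  split; first by exists iD.
  move=> X f B q s _ qf.
  exists (fun i => if i is _.+1 then 0 else f 0%N \oc pA + s \oc pD).
  split=> //=.
    by rewrite compmDl -!compmA piA pDA compm1 compm0 addr0.
  by rewrite compmDr !compmA qf comp0m add0r.
have [S0 [_ S0P]] := IHn zero_ob.
have zk : is_kernel (idmor D) (0 : mor zero_ob D).
  apply/kernelP; split=> [||T x]; first by rewrite comp1m.
    by move=> T x y _; rewrite (proj1 (zero_obP T) x) (proj1 (zero_obP T) y).
  by rewrite comp1m => ->; exists 0; rewrite comp0m.
have [S [a [b [c [d [[_ _ a0 aS] [ab cd SZ Sc]]]]]]] :=
  splice_right S0 zk (@idm_epi _ D).
exists S; split; first by exists d; rewrite Sc comp1m.
move=> X f B q s ff qf.
(* The lower part maps by induction, with zero in the role of [s]; the last component is [s]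
   itself. *)
have [||phi [phi0 phiS phin]] := S0P X f _ (f n.+1) 0.
- by move=> i ilt; apply: ff; apply: ltnW.
- exact: ff.
have [psi [psin psiE]] := @override_at (fun i => mor (ext_ob S i) (X i))
  (fun i => phi i \oc a i) n.+1 (s \oc c).
have psilt i : (i <= n)%N -> psi i = phi i \oc a i.
  by move=> ilt; apply: psiE; rewrite neq_ltn ltnS ilt.
exists psi; split.
- by rewrite psilt // -compmA a0.
- move=> i; rewrite ltnS leq_eqVlt => /predU1P[->|ilt].
    rewrite psin psilt // SZ compm0 comp0m compm0 compmA phin.
    by rewrite compm0 !comp0m.
  by rewrite !psilt ?(ltnW ilt) // -compmA aS // !compmA phiS.
by rewrite psin Sc comp1m compmA.
Qed.

(** [Y] is the cokernel of [(m, -c)] from [M] to the biproduct. The hypothesis makes this morphism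
    mono, hence the kernel of its cokernel, so the pushout square is also a pullback. *)
Lemma pushout_exists (M X Z : C) (m : mor M X) (c : mor M Z) :
  (forall (T : C) (t : mor T M), m \oc t = 0 -> c \oc t = 0 -> t = 0) ->
  exists (Y : C) (j : mor X Y) (d : mor Z Y), [/\ is_pullback m c j d,
    jointly_epi j d
  & forall (T : C) (x : mor X T) (z : mor Z T), x \oc m = z \oc c ->
      exists2 y : mor Y T, y \oc j = x & y \oc d = z].
Proof.
move=> mcm.
have [S [iX [iZ [pX [pZ [piX piZ pXZ pZX pS]]]]]] := biproductP X Z.
pose k := iX \oc m - iZ \oc c.
have pXk : pX \oc k = m.
  by rewrite compmBr !compmA piX pXZ comp1m comp0m subr0.
have pZk : pZ \oc k = - c.
  by rewrite compmBr !compmA piZ pZX comp1m comp0m sub0r.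
have km : is_mono k.
  apply/monoP => T t kt; apply: mcm; first by rewrite -pXk -compmA kt compm0.
  by apply: oppr_inj; rewrite -compNm -pZk -compmA kt compm0 oppr0.
have qk := cokerm0 k; set q := cokerm k in qk.
have kP T (x : mor T S) : q \oc x = 0 -> exists y, k \oc y = x.
  have [D [g /kernelP[gk _ gP]]] := mono_normal km.
  move=> qx; apply: gP.
  have /cokernelP[_ _ /(_ D g gk)[g' <-]] := cokermP k.
  by rewrite -compmA qx compm0.
exists _, (q \oc iX), (q \oc iZ); split.
- split=> //.
    by apply/eqP; rewrite -subr_eq0 -!compmA -compmBr; apply/eqP.
  move=> T x z qxz; have [|t kt] := kP T (iX \oc x - iZ \oc z).
    by rewrite compmBr !compmA qxz subrr.
  exists t; rewrite -pXk -[c]opprK -pZk compNm -!compmA kt.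
  by rewrite !compmBr !compmA piX piZ pXZ pZX !comp0m !comp1m subr0 sub0r opprK.
- move=> T t; rewrite !compmA => tX tZ; apply: (@cokerm_epi _ _ _ k).
  by rewrite comp0m -[LHS]compm1 -pS compmDr !compmA tX tZ !comp0m addr0.
move=> T x z xm.
have /cokernelP[_ _ /(_ T (x \oc pX + z \oc pZ))] := cokermP k.
case=> [|y yq]; first by rewrite compmDl -!compmA pXk pZk compmN xm subrr.
by exists y; rewrite compmA yq compmDl -!compmA ?piX ?piZ ?pXZ ?pZX
  !compm0 compm1 ?addr0 ?add0r.
Qed.

(** Cuts [E] at the kernel of its end morphism, so that an induction on the degree can treat the
    part to the left. *)
Lemma truncate n D A (E : extension n.+1 D A) :
  exists p : mor (ext_ob E n) (ker_ob (ext_end E)),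
  [/\ exact (ext_map E n) p, is_epi p
    & kerm (ext_end E) \oc p = ext_map E n.+1].
Proof.
have /exactP[ef efP] := ext_exact_end E.
have /exactP[ff ffP] := ext_exact E (ltnSn n).
have [p pE] := kerm_lift ef.
exists p; split=> //.
  apply/exactP; split.
    by apply: (@kerm_mono _ _ _ (ext_end E)); rewrite compmA pE compm0.
  by move=> T b pb; apply: ffP; rewrite -pE -compmA pb compm0.
have [|T [e [a [ee fa]]]] := efP _ (kerm (ext_end E)); first exact: kerm0.
apply: (@epi_of_comp _ _ _ _ _ a); suff -> : p \oc a = e by [].
by apply: (@kerm_mono _ _ _ (ext_end E)); rewrite compmA pE.
Qed.

Lemma jointly_epi_lift (X Z Y : C) (j : mor X Y) (d : mor Z Y) T (w : mor T Y) :
  jointly_epi j d ->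
  exists (T' : C) (e : mor T' T) (x : mor T' X) (z : mor T' Z),
    is_epi e /\ j \oc x + d \oc z = w \oc e.
Proof.
move=> jd.
have [S [iX [iZ [pX [pZ [piX piZ pXZ pZX pS]]]]]] := biproductP X Z.
have je : is_epi (j \oc pX + d \oc pZ).
  apply/epiP => T1 t t0; apply: jd.
    by rewrite -[j]compm1 -piX -[RHS](comp0m _ iX) -t0 compmDr compmDl !compmA
      -(compmA _ pZ) pZX compm0 addr0.
  by rewrite -[d]compm1 -piZ -[RHS](comp0m _ iZ) -t0 compmDr compmDl !compmA
    -(compmA _ pX) pXZ compm0 add0r.
have [T' [e [a [ee ae]]]] := epi_lift w je.
exists T', e, (pX \oc a), (pZ \oc a); split=> //.
by rewrite -ae compmDl !compmA.
Qed.

(* The Mayer-Vietoris step: as the class of [E] and the zero class on [Z] agree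
   on [M], they come from a class on [Y], which vanishes along [d]. *)
Lemma glue n D A (E : extension n D A) M Z Y (m : mor M D) (c : mor M Z)
    (j : mor D Y) (d : mor Z Y) :
  is_pullback m c j d -> jointly_epi j d ->
  triv_along (ext_map E) (ext_end E) m ->
  exists G : extension n Y A,
    morphism_over E G j /\ exists s, ext_end G \oc s = d.
Proof.
elim: n D E M Z Y m c j d => [|n IHn] D E M Z Y m c j d pbk je.
  have [jd pb jm] := pbk.
  case: E => X f e fm fex eex ee /= [s es].
  have /exactP[ef eP] := eex.
  (* In degree one, [G] is the pushout of the lift [s] of [m] and of [c]; its leg [b] is the
     required lift of [d]. *)
  have [|G [a [b [[ab gpb gjm] gje gpo]]]] := @pushout_exists _ _ _ s c.
    by move=> T t st ct; apply: jm => //; rewrite -es -compmA st compm0.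
  have [|q qa qb] := gpo _ (j \oc e) d; first by rewrite -compmA es.
  have qe : is_epi q.
    apply/epiP => T t tq; apply: je.
      by apply: ee; rewrite comp0m -compmA -qa compmA tq comp0m.
    by rewrite -qb compmA tq comp0m.
  have afm : is_mono (a \oc f 0%N).
    apply/monoP => T t aft.
    have [|u [su cu]] := gpb T (f 0%N \oc t) 0; first by rewrite compm0 compmA.
    have u0 : u = 0.
      by apply: jm => //; rewrite -es -compmA su compmA ef comp0m.
    by apply: fm; rewrite -su u0 !compm0.
  have gex : exact (a \oc f 0%N) q.
    apply/exactP; split; first by rewrite compmA qa -compmA ef compm0.
    move=> T x qx.
    have [T1 [e1 [x1 [z1 [e1e xE]]]]] := jointly_epi_lift x gje.
    (* An element of the kernel of [q] is locally a sum from [X 0] and [Z]; up to sign the two parts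
       agree in [Y], so they come from some [t] in [M], and only an element of [A] remains. *)
    have [|t [mt ct]] := pb T1 (e \oc x1) (- z1).
      apply/eqP; rewrite compmN -subr_eq0 opprK !compmA -qa -qb -!compmA.
      by rewrite -compmDr xE compmA qx comp0m.
    have [|T2 [e2 [u [e2e fu]]]] := eP T1 (x1 - s \oc t).
      by rewrite compmBr compmA es mt subrr.
    exists T2, (e1 \oc e2), u; split; first exact: epi_comp.
    rewrite -compmA fu !compmA -xE; congr (_ \oc _).
    by rewrite compmBr compmA ab -compmA ct compmN opprK.
  pose g i : mor (aug A (fun=> G) i) G := if i is _.+1 then 0 else a \oc f 0%N.
  have nex i : (i < 0)%N -> exact (g i) (g i.+1) by [].
  exists (@Extension C 0 Y A (fun=> G) g q afm nex gex qe); split; last by exists b.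
  by exists (fun i => if i is _.+1 then 0 else a).
move=> [Z1 [z1 [y [z1e ey ty]]]].
have [jd pb jm] := pbk.
have [p [pex pe pE]] := truncate E.
pose F := Extension (@ext_mono _ _ _ _ E)
  (fun i lt => ext_exact E (ltnW lt)) pex pe.
(* The last term of [G] will be the biproduct of [ext_ob E n.+1] and [Z], mapped to [Y] by
   [j \oc ext_end E] and [- d]; [N] is the kernel of that morphism. *)
have [N [u [v pbN]]] := pullback_exists (j \oc ext_end E) d.
have [uv pN jN] := pbN.
have [|kn [ukn vkn]] := pN _ (kerm (ext_end E)) 0.
  by rewrite compm0 -compmA kerm0 compm0.
have [|w [uw vw]] := pN _ y (c \oc z1).
  by rewrite -compmA ey !compmA jd.
have [|m1 m1E] := @kerm_lift _ _ _ (ext_end E) _ (y \oc kerm z1).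
  by rewrite compmA ey -compmA kerm0 compm0.
have sq : kn \oc m1 = w \oc kerm z1.
  apply/eqP; rewrite -subr_eq0; apply/eqP; apply: jN; rewrite compmBr !compmA.
    by rewrite ukn uw m1E subrr.
  by rewrite vkn vw comp0m -compmA kerm0 compm0 subrr.
(* The induction extends [F] from the kernel of [ext_end E] to [N]: the kernel of [z1] is the
   pullback of [kn] and [w], which are jointly epi, and [F] is trivial along [m1]. *)
have [G' [[phi [phi0 phiE phin]] _]] :
    exists G' : extension n N A, morphism_over F G' kn /\
      exists s, ext_end G' \oc s = w.
  apply: (@IHn _ F (ker_ob z1) Z1 N m1 (kerm z1) kn w).
  - split=> // [T x z knx|T t _ kt]; last first.
      by apply: (@kerm_mono _ _ _ z1); rewrite kt compm0.
    have kx : kerm (ext_end E) \oc x = y \oc z by rewrite -ukn -uw -!compmA knx.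
    have [|t zt] := @kerm_lift _ _ _ z1 _ z.
      apply: jm; first by rewrite compmA -ey -compmA -kx compmA kerm0 comp0m.
      by rewrite compmA -vw -compmA -knx compmA vkn comp0m.
    exists t; split=> //; apply: (@kerm_mono _ _ _ (ext_end E)).
    by rewrite compmA m1E kx -compmA zt.
  (* Modulo [kn], an element of [N] is determined by its image [r] in [M]; once [r] is lifted to
     [Z1], subtracting its image under [w] leaves an element of the kernel of [ext_end E]. *)
  - move=> T t tk tw.
    have [|r [mr cr]] := pb _ (ext_end E \oc u) v; first by rewrite compmA uv.
    have [T1 [e [x [ee zx]]]] := epi_lift r z1e.
    have [|k kE] := @kerm_lift _ _ _ (ext_end E) _ (u \oc e - y \oc x).
      by rewrite compmBr !compmA ey -!compmA zx !compmA mr subrr.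
    suff eE : e = kn \oc k + w \oc x.
      by apply: ee; rewrite eE comp0m compmDr !compmA tk tw !comp0m addr0.
    apply/eqP; rewrite -subr_eq0; apply/eqP.
    apply: jN; rewrite compmBr compmDr !compmA.
      by rewrite ukn uw kE subrK subrr.
    by rewrite vkn vw comp0m add0r -compmA zx compmA cr subrr.
  apply: (@triv_mono _ _ _ _ _ _ _ _ (kerm (ext_end E))).
    exact: kerm_mono.
  by rewrite pE m1E.
have [S [iE [iZ [pE' [pZ [piE piZ pEZ pZE pS]]]]]] :=
  biproductP (ext_ob E n.+1) Z.
pose l := iE \oc u + iZ \oc v.
pose q := j \oc ext_end E \oc pE' - d \oc pZ.
have lE : pE' \oc l = u.
  by rewrite compmDr !compmA piE pEZ comp1m comp0m addr0.
have lZ : pZ \oc l = v.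
  by rewrite compmDr !compmA piZ pZE comp1m comp0m add0r.
have qE : q \oc iE = j \oc ext_end E.
  by rewrite compmBl -!compmA piE pZE compm0 compm1 subr0.
have qZ : q \oc iZ = - d.
  by rewrite compmBl -!compmA piZ pEZ !compm0 compm1 sub0r.
have lkn : l \oc kn = iE \oc kerm (ext_end E).
  by rewrite compmDl -!compmA ukn vkn compm0 addr0.
have lk : is_kernel q l.
  apply/kernelP; split.
  - by rewrite compmBl -!compmA lE lZ compmA uv subrr.
  - apply/monoP => T x lx; apply: jN; first by rewrite -lE -compmA lx compm0.
    by rewrite -lZ -compmA lx compm0.
  move=> T x qx; have [|t [ut vt]] := pN _ (pE' \oc x) (pZ \oc x).
    by apply/eqP; rewrite -subr_eq0 !compmA -compmBl; apply/eqP.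
  by exists t; rewrite -[x]comp1m -pS /l !compmDl -!compmA ut vt.
have qe : is_epi q.
  apply/epiP => T t tq; apply: je.
    apply: (@ext_epi _ _ _ _ E).
    by rewrite comp0m -compmA -qE compmA tq comp0m.
  by apply: oppr_inj; rewrite oppr0 -compmN -qZ compmA tq comp0m.
have [G [a [b [x [x' [[b0 bE a0 aE] [ab xx' GE Gx]]]]]]] :=
  splice_right G' lk qe.
exists G; split; last first.
  (* [q] restricts to [- d] on [Z], hence the sign. *)
  exists (- (x' \oc iZ)).
  by rewrite compmN Gx compmA -(compmA q) xx' compm1 qZ opprK.
(* The comparison consists of that of [F] with [G'] and, in last place, of the inclusion into the
   biproduct. *)
have [psi [psin psiE]] := @override_at (fun i => mor (ext_ob E i) (ext_ob G i))
  (fun i => b i \oc phi i) n.+1 (x' \oc iE).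
have psilt i : (i <= n)%N -> psi i = b i \oc phi i.
  by move=> ilt; apply: psiE; rewrite neq_ltn ltnS ilt.
exists psi; split.
- by rewrite psilt // -compmA phi0.
- move=> i; rewrite ltnS leq_eqVlt => /predU1P[->|ilt].
    rewrite psin psilt // GE -!compmA (compmA (a n)) ab comp1m phin.
    by rewrite (compmA l) lkn -compmA pE.
  by rewrite !psilt ?(ltnW ilt) // -compmA phiE // !compmA bE.
by rewrite psin Gx compmA -(compmA q) xx' compm1 qE.
Qed.

End Gluing.

(** * Vanishing of Yoneda Ext and its consequences *)

Section Vanishing.
Variable C : abelianCat.
Implicit Types A B D K L : C.

Definition trivial_ext n D A (E : extension n D A) : Prop :=
  triv_along (ext_map E) (ext_end E) (idmor D).

Lemma trivial_reflect n D D' A (E : extension n D A) (E' : extension n D' A)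
    (h : mor D D') :
  morphism_over E E' h -> triv_along (ext_map E') (ext_end E') h ->
  trivial_ext E.
Proof.
move=> [phi [phi0 phiE phin]] th.
apply: (triv_reflect (@ext_mono _ _ _ _ E) (@ext_mono _ _ _ _ E') phi0
  (ext_exact E) (ext_exact_end E) (ext_exact E') (ext_exact_end E') phiE phin).
  exact: epi_lift (@ext_epi _ _ _ _ E).
by rewrite compm1.
Qed.

Lemma ext_morphism_trivial n D A (E E' : extension n D A) :
  ext_morphism E E' -> trivial_ext E <-> trivial_ext E'.
Proof.
move=> [phi [phi0 phiE phin]].
have phi1 : ext_end E' \oc phi n = idmor D \oc ext_end E by rewrite comp1m.
split=> tE; last by apply: (trivial_reflect _ tE); exists phi.
by have := triv_push phiE phi1 tE; rewrite compm1.
Qed.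

Lemma yoneda_equiv_trivial n D A (E E' : extension n D A) :
  yoneda_equiv E E' -> trivial_ext E <-> trivial_ext E'.
Proof.
elim=> {E E'} [E E'|E|E E' _ IH|E E' E'' _ IH _ IH'] //.
- exact: ext_morphism_trivial.
- exact: iff_sym.
exact: iff_trans IH IH'.
Qed.

Lemma section_trivial n D A (E : extension n D A) s :
  ext_end E \oc s = idmor D -> trivial_ext E.
Proof. by rewrite /trivial_ext => <-; apply: triv_lift. Qed.

(** A trivial [E] is joined to the split extension by a zigzag [E -> G <- S], where [G] has a
    section and comes from gluing along the square of identities of [D]. *)
Lemma ext_vanishesP n D A :
  ext_vanishes n D A <-> forall E : extension n D A, trivial_ext E.
Proof.
have [S [[s Ss] SP]] := split_extension n D A.
split=> [van E|tE].
  exact/(yoneda_equiv_trivial (van S E))/(section_trivial Ss).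
suff ES E : yoneda_equiv E S.
  by move=> E E'; apply: rst_trans (ES E) _; apply/rst_sym/ES.
have [||G [[phi [phi0 phiE phin]] [t Gt]]] :=
  @glue _ _ _ _ E D D D (idmor D) (idmor D) (idmor D) (idmor D) _ _ (tE E).
- split=> // [T x z|T x]; last by rewrite comp1m.
  by rewrite !comp1m => ->; exists z; rewrite comp1m.
- by move=> T x; rewrite compm1.
apply: (@rst_trans _ _ _ G).
  by apply: rst_step; exists phi; split=> //; rewrite phin comp1m.
apply/rst_sym/rst_step.
have [|| psi [psi0 psiE psin]] := SP _ (ext_map G) _ (ext_end G) t.
- by move=> i /(ext_exact G)/exactP[].
- by have /exactP[] := ext_exact_end G.
by exists psi; split=> //; rewrite psin Gt comp1m.
Qed.

(** Composing [ext_end] with [u] turns an extension of [D] into one of [D'], which avoids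
    constructing an inverse of [u]. *)
Lemma ext_vanishes_mono_epi n D D' A (u : mor D D') :
  is_mono u -> is_epi u -> ext_vanishes n D' A -> ext_vanishes n D A.
Proof.
move=> um ue /ext_vanishesP van; apply/ext_vanishesP => E.
have uEx : exact (ext_map E n) (u \oc ext_end E).
  have /exactP[ef eP] := ext_exact_end E.
  apply/exactP; split; first by rewrite -compmA ef compm0.
  by move=> T b; rewrite -compmA -[RHS](compm0 _ u) => /um; apply: eP.
have uEe := epi_comp ue (@ext_epi _ _ _ _ E).
pose E' := Extension (@ext_mono _ _ _ _ E) (ext_exact E) uEx uEe.
have /(@triv_comp _ _ _ _ _ _ _ _ _ _ u) := van E'.
by rewrite comp1m -{1}[u]compm1; apply: triv_mono.
Qed.

(** The splice of [E] with 0 -> X -> Y -> D -> 0 is trivial; this gives a covering [z] of [D] that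
    lifts to [y : Z -> Y], with [E] trivial along the kernel of [z], the pullback of [j] and [y].
    Gluing yields an extension of [Y] whose pullback along [j] is the class of [E]; it is trivial by
    the hypothesis on [Y]. *)
Lemma ext_vanishes_shift n X Y D A (j : mor X Y) (q : mor Y D) :
  short_exact j q -> ext_vanishes n Y A -> ext_vanishes n.+1 D A ->
  ext_vanishes n X A.
Proof.
move=> /sesP[jk qe] /ext_vanishesP vY /ext_vanishesP vD.
have /kernelP[qj jm jP] := jk.
apply/ext_vanishesP => E.
have [S [a [b [c [d [[_ _ a0 aS] [ab cd SY Sc]]]]]]] := splice_right E jk qe.
have [Z [z [y0 [ze zy ty]]]] := vD S.
pose y := c \oc y0.
have qy : q \oc y = z by rewrite /y compmA -Sc zy comp1m.
have [m jmE] : exists m, j \oc m = y \oc kerm z.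
  by apply: jP; rewrite compmA qy kerm0.
have tm : triv_along (ext_map E) (ext_end E) m.
  apply: (triv_mono jm); rewrite jmE /y -compmA.
  apply: (triv_push aS _ ty).
  by rewrite SY !compmA cd comp1m.
have [||G [Eg [s Gs]]] := @glue _ _ _ _ E (ker_ob z) Z Y m (kerm z) j y _ _ tm.
- split=> // [T x t jx|T t _ kt]; last first.
    by apply: (@kerm_mono _ _ _ z); rewrite kt compm0.
  have [|t' zt'] := @kerm_lift _ _ _ z _ t.
    by rewrite -qy -compmA -jx compmA qj comp0m.
  by exists t'; split=> //; apply: jm; rewrite compmA jmE -compmA zt'.
- move=> T t tj ty0; have [t' t'q] := epi_desc qe jk tj.
  suff t'0 : t' = 0 by rewrite -t'q t'0 comp0m.
  by apply: ze; rewrite comp0m -qy compmA t'q.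
apply: (trivial_reflect Eg); rewrite -[j]comp1m; apply: triv_comp; exact: vY.
Qed.

Lemma ext_section A B D (k : mor A B) (q : mor B D) :
  short_exact k q -> ext_vanishes 0 D A -> exists s, q \oc s = idmor D.
Proof.
move=> [km kq qe] /ext_vanishesP van.
pose f i : mor (aug A (fun=> B) i) B := if i is _.+1 then 0 else k.
have fex i : (i < 0)%N -> exact (f i) (f i.+1) by [].
(* In degree one, triviality along the identity unfolds to the existence of a section. *)
exact: van (@Extension C 0 D A (fun=> B) f q km fex kq qe).
Qed.

(** The sequence pulled back along [h] splits; its section, followed by the projection to [B], lifts
    [h]. *)
Lemma ext_lift A B D (k : mor A B) (q : mor B D) T (h : mor T D) :
  short_exact k q -> ext_vanishes 0 T A -> exists h', q \oc h' = h.
Proof.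
move=> /sesP[kk qe] van.
have [P [p [r pb]]] := pullback_exists h q.
have [k' k'k _] := pullback_ker pb kk.
have /ext_section/(_ van)[s ps] : short_exact k' p.
  by apply/sesP; split=> //; apply: pullback_epi pb qe.
by exists (r \oc s); case: pb => hp _ _; rewrite compmA -hp -compmA ps compm1.
Qed.

(** The pushout along [h] is an extension of [D] by [T], which splits; the resulting retraction [r]
    of [b], composed with [a], extends [h]. *)
Lemma ext_extend A B D (k : mor A B) (q : mor B D) T (h : mor A T) :
  short_exact k q -> ext_vanishes 0 D T -> exists h', h' \oc k = h.
Proof.
move=> kq van; have [km /exactP[qk qP] qe] := kq.
have [|P [a [b [pb ab po]]]] := @pushout_exists _ _ _ _ k h.
  by move=> S t kt _; apply: km; rewrite kt compm0.
have [akb pP pm] := pb.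
have [|p pa p0] := po _ q 0; first by rewrite comp0m qk.
have pe : is_epi p by apply: (@epi_of_comp _ _ _ _ _ a); rewrite pa.
have bp : short_exact b p.
  split=> //.
    apply/monoP => S x bx.
    have [|t [kt <-]] := pP S 0 x; first by rewrite bx compm0.
    by rewrite (km _ t 0) ?compm0.
  apply/exactP; split=> // S x px.
  have [S1 [e1 [x1 [z1 [e1e xE]]]]] := jointly_epi_lift x ab.
  have [|S2 [e2 [t [e2e kt]]]] := qP _ x1.
    have axE : a \oc x1 = x \oc e1 - b \oc z1 by rewrite -xE addrK.
    by rewrite -pa -compmA axE compmBr !compmA px p0 !comp0m subrr.
  exists S2, (e1 \oc e2), (h \oc t + z1 \oc e2); split; first exact: epi_comp.
  by rewrite compmDr !compmA -akb -xE compmDl -!compmA kt.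
have [s ps] := ext_section bp van.
have [/kernelP[_ bm bP] _] := (sesP b p).1 bp.
have [r br] : exists r, b \oc r = idmor P - s \oc p.
  by apply: bP; rewrite compmBr compm1 compmA ps comp1m subrr.
exists (r \oc a); apply: bm; rewrite !compmA br compmBl comp1m compmBl.
by rewrite -(compmA s) pa -(compmA s) qk compm0 subr0 akb.
Qed.

End Vanishing.

(** * Coresolutions, covers and envelopes *)

Section Coresolutions.
Variable C : abelianCat.
Implicit Types A B D K L M Z : C.
Implicit Types P Q : C -> Prop.

(** Isomorphisms are expressed as morphisms both mono and epi, which is equivalent in an abelian
    category. *)
Definition iso_closed P : Prop :=
  forall A B (f : mor A B), is_mono f -> is_epi f -> P A <-> P B.

Lemma zero_ob_l A (f : mor zero_ob A) : f = 0.
Proof. exact: (proj2 (zero_obP A)). Qed.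

Lemma zero_ob_r A (f : mor A zero_ob) : f = 0.
Proof. exact: (proj1 (zero_obP A)). Qed.

Lemma ses_iso_zero A B (f : mor A B) :
  is_mono f -> is_epi f -> short_exact f (0 : mor B zero_ob).
Proof.
move=> fm fe; split=> //.
  apply/exactP; split=> [|T b _]; first by rewrite comp0m.
  by have [T' [e [a [ee fa]]]] := epi_lift b fe; exists T', e, a.
by move=> T x y _; rewrite (zero_ob_l x) (zero_ob_l y).
Qed.

Lemma ses_zero_iso A B (f : mor A B) :
  is_mono f -> is_epi f -> short_exact (0 : mor zero_ob A) f.
Proof.
move=> /monoP fm fe; apply/sesP; split=> //; apply/kernelP; split.
- by rewrite compm0.
- by move=> T x y _; rewrite (zero_ob_r x) (zero_ob_r y).
by move=> T x /fm ->; exists 0; rewrite comp0m.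
Qed.

(** An isomorphism fits into short exact sequences with a zero object at either end. *)
Lemma extension_closed_iso P : extension_closed P -> P zero_ob -> iso_closed P.
Proof.
move=> cP P0 A B f fm fe; split=> [PA|PB].
  exact: cP (ses_iso_zero fm fe) PA P0.
exact: cP (ses_zero_iso fm fe) P0 PB.
Qed.

Lemma coresolution_sub P P' Q Q' M n :
  (forall X, P X -> P' X) -> (forall X, Q X -> Q' X) ->
  has_coresolution P Q M n -> has_coresolution P' Q' M n.
Proof.
move=> PP QQ [X [f [fex [[PX QX] QXk Pim]]]]; exists X, f; split=> //.
by split=> [|k /QXk /QQ //|k /Pim /PP //]; split; [apply: PP | apply: QQ].
Qed.

Lemma coresolution0 P Q M : P M -> Q M -> has_coresolution P Q M 0.
Proof.
move=> PM QM.
pose f i : mor (aug M (fun=> M) i) M := if i is _.+1 then 0 else idmor M.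
exists (fun=> M), f.
by split; split=> //; [apply: idm_mono | apply: idm_epi | case].
Qed.

Lemma coresolution0_iso P Q M : has_coresolution P Q M 0 ->
  exists X (f : mor M X), [/\ is_mono f, is_epi f, P X & Q X].
Proof. by case=> X [f [[fm _ fe] [[PX QX] _ _]]]; exists (X 0%N), (f 0%N). Qed.

(** [Y] is the image of [f 1], and the rest of the sequence coresolves it. For [n = 0] the image
    condition is empty, and [P Y] follows from [P (X 1)] because [f 1] is epi. *)
Lemma coresolution_uncons P Q M n :
  iso_closed P -> has_coresolution P Q M n.+1 ->
  exists (X Y : C) (g : mor M X) (p : mor X Y),
    [/\ short_exact g p, Q X, P Y & has_coresolution P Q Y n].
Proof.
move=> iP [X [f [[fm fex fe] [PQX QX Pim]]]].
have [e ee ie] := im_epi (f 1%N).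
have im_mono : is_mono (imm (f 1%N)) by exact: kerm_mono.
have PY : P (im (f 1%N)).
  case: n fe PQX Pim {fex QX} => [|n] fe [PX _] Pim; last exact: Pim.
  apply/(iP _ _ (imm (f 1%N))) => //.
  by apply: (@epi_of_comp _ _ _ _ _ e); rewrite ie.
exists (X 0%N), (im (f 1%N)), (f 0%N), e; split=> //; last 1 first.
- pose f' i : mor (aug (im (f 1%N)) (fun i => X i.+1) i) (X i.+1) :=
    match i with 0 => imm (f 1%N) | j.+1 => f j.+2 end.
  exists (fun i => X i.+1), f'; split; split=> //.
  + case=> [|i] ilt; last exact: fex.
    have /exactP[ff ffP] := fex 1%N ilt.
    apply/exactP; split=> [|T b /ffP[T' [e' [a [e'e fa]]]]].
      by apply: ee; rewrite -compmA ie ff comp0m.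
    by exists T', e', (e \oc a); split=> //; rewrite compmA ie.
  + case: n fe {fex PQX QX Pim} => [|n] fe //=.
    by apply: (@epi_of_comp _ _ _ _ _ e); rewrite ie.
  + by move=> k klt; apply: QX.
  + by case=> [//|k] klt; apply: Pim.
- split=> //; have /exactP[ff ffP] := fex 0%N isT.
  apply/exactP; split; first by apply: im_mono; rewrite compmA ie ff compm0.
  by move=> T b eb; apply: ffP; rewrite -ie -compmA eb compm0.
exact: QX.
Qed.

Lemma coresolution_cons P Q M X Y n (g : mor M X) (p : mor X Y) :
  iso_closed P -> short_exact g p -> Q X -> P Y ->
  has_coresolution P Q Y n -> has_coresolution P Q M n.+1.
Proof.
move=> iP [gm gp pe] QX PY [X' [f [[fm fex fe] [PQX QX' Pim]]]].
pose f' i : mor (aug M (aug X X') i) (aug X X' i) :=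
  match i with 0 => g | 1 => f 0%N \oc p | j.+2 => f j.+1 end.
exists (aug X X'), f'; split; split=> //.
- have /exactP[gp0 gpP] := gp.
  case=> [|[|i]] ilt; last exact: fex.
    apply/exactP; split; first by rewrite /= -compmA gp0 compm0.
    move=> T b; rewrite /= -compmA => fpb; apply: gpP.
    by apply: fm; rewrite fpb compm0.
  have /exactP[ff ffP] := fex 0%N ilt.
  apply/exactP; split; first by rewrite /= compmA ff comp0m.
  move=> T b /ffP[T1 [e1 [a [e1e fa]]]].
  have [T2 [e2 [c [e2e pc]]]] := epi_lift a pe.
  exists T2, (e1 \oc e2), c; split; first exact: epi_comp.
  by rewrite /= -compmA pc !compmA fa.
- by case: n fe {fex PQX QX' Pim} => [|n] fe //=; apply: epi_comp.
- by case=> [//|k] klt; apply: QX'.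
case=> [//|[|k]] klt; last exact: Pim.
(* Only at index 1 is the image new: that of [f 0 \oc p] is [Y] up to isomorphism. *)
have [u um ue] := im_mono_epi fm pe.
exact/(iP _ _ u um ue).
Qed.

Lemma coresdim_exists P Q M n :
  has_coresolution P Q M n -> exists2 m, coresdim_is P Q M m & (m <= n)%N.
Proof.
move=> Mn.
have [m [[Mm mP] _]] := Wf_nat.dec_inh_nat_subset_has_unique_least_element
  (has_coresolution P Q M) (fun=> classic _) (ex_intro _ n Mn).
by exists m; [split=> // k /mP/leP | apply/leP/mP].
Qed.

Variables U V W : C -> Prop.
Hypotheses (hUV : forall X, U X -> V X) (hU : extension_closed U).
Hypotheses (hV : extension_closed V) (hW : relative_generator W U).
Hypothesis (h0 : U zero_ob).

Let V_iso : iso_closed V.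
Proof. by apply: extension_closed_iso => //; apply: hUV. Qed.

(** The pullback [M] of [p] and [f] is at once an extension of [X] by [K] and of [B] by [Z]. *)
Lemma cover_envelope_step Z X Y (g : mor Z X) (p : mor X Y)
    K B (k : mor K B) (f : mor B Y) :
  short_exact g p -> U X -> V Y ->
  short_exact k f -> U K ->
  exists M (g' : mor Z M) (p' : mor M B),
    [/\ short_exact g' p', U M & V B].
Proof.
move=> /sesP[gk pe] UX VY kf UK; have /sesP[kk fe] := kf.
have [M [r [s pb]]] := pullback_exists p f.
have [k' k'k _] := pullback_ker pb kk.
have [g' g'k _] := pullback_ker (pullback_sym pb) gk.
exists M, g', s; split.
- by apply/sesP; split=> //; apply: pullback_epi (pullback_sym pb) pe.
- have k'r : short_exact k' r.
    by apply/sesP; split=> //; apply: pullback_epi pb fe.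
  exact: hU k'r UK UX.
exact: hV kf (hUV UK) VY.
Qed.

(** With [Y -> M] a cover from the relative generator, [B] is the kernel of the composite
    [Y -> M -> D], so [Y] can be put in front of the coresolution of [D]. *)
Lemma cover_of_envelope Z M D n (g : mor Z M) (p : mor M D) :
  short_exact g p -> U M -> V D -> has_coresolution V W D n ->
  exists K B (k : mor K B) (f : mor B Z),
    [/\ short_exact k f, U K & has_coresolution V W B n.+1].
Proof.
move=> /sesP[gk pe] UM VD Dn.
have [K [Y [k [f [/sesP[kk fe] WY UK]]]]] := hW.2 _ UM.
have [B [r [s pb]]] := pullback_exists f g.
have [k' k's _] := pullback_ker (pullback_sym pb) kk.
exists K, B, k', s; split=> //.
  by apply/sesP; split=> //; apply: pullback_epi (pullback_sym pb) fe.
have rpf : short_exact r (p \oc f).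
  by apply/sesP; split; [apply: pullback_of_kernel pb gk | apply: epi_comp].
exact: coresolution_cons rpf WY VD Dn.
Qed.

Lemma cover_exists Z n : has_coresolution V U Z n ->
  exists K B (k : mor K B) (f : mor B Z),
    [/\ short_exact k f, U K & has_coresolution V W B n].
Proof.
elim: n Z => [|n IHn] Z Zn.
  have [X [f [fm fe _ UX]]] := coresolution0_iso Zn.
  have UZ : U Z by apply/(extension_closed_iso hU h0 fm fe).
  have [K [Y [k [q [kq WY UK]]]]] := hW.2 _ UZ.
  exists K, Y, k, q; split=> //.
  by apply: coresolution0 => //; apply/hUV/hW.1.
have [X [Y [g [p [gp UX VY Yn]]]]] := coresolution_uncons V_iso Zn.
have [K [B [k [f [kf UK Bn]]]]] := IHn _ Yn.
have [M [g' [p' [g'p' UM VB]]]] := cover_envelope_step gp UX VY kf UK.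
exact: cover_of_envelope g'p' UM VB Bn.
Qed.

Lemma envelope_exists Z n : has_coresolution V U Z n.+1 ->
  exists M D (g : mor Z M) (p : mor M D),
    [/\ short_exact g p, U M, V D & has_coresolution V W D n].
Proof.
move=> Zn; have [X [Y [g [p [gp UX VY Yn]]]]] := coresolution_uncons V_iso Zn.
have [K [B [k [f [kf UK Bn]]]]] := cover_exists Yn.
have [M [g' [p' [g'p' UM VB]]]] := cover_envelope_step gp UX VY kf UK.
by exists M, B, g', p'.
Qed.

(* [W] need not contain [zero_ob]: a cover [Y] of it in [W] yields the
   coresolution 0 -> 0 -> Y = Y -> 0. *)
Lemma zero_pair_vee : pair_vee V W zero_ob.
Proof.
have [_ [Y [_ [_ [_ WY _]]]]] := hW.2 _ h0.
have VY : V Y by apply/hUV/hW.1.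
split; first exact: hUV.
exists 1%N; apply: coresolution_cons V_iso _ WY VY (coresolution0 VY WY).
exact: ses_zero_iso (@idm_mono _ _) (@idm_epi _ _).
Qed.

(** Shifting along 0 -> X -> Y -> D -> 0 uses the vanishing for [D] one degree higher, so the
    induction treats all degrees at once. *)
Lemma vee_left_perp : (forall X, W X -> left_perp U X) ->
  forall X, vee W X -> left_perp U X.
Proof.
move=> Wperp X [n Xn] A UA.
elim: n X Xn => [|n IHn] X Xn i.
  have [Y [f [fm fe _ WY]]] := coresolution0_iso Xn.
  by apply: ext_vanishes_mono_epi fm fe _; apply: Wperp.
have [//|Y [D [g [p [gp WY _ Dn]]]]] := coresolution_uncons _ Xn.
by apply: ext_vanishes_shift gp _ (IHn _ Dn _); apply: Wperp.
Qed.

Lemma vee_in_vee P Q M : vee_in P Q M -> vee Q M.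
Proof. by case=> n Mn; exists n; apply: coresolution_sub Mn. Qed.

End Coresolutions.

Theorem theorem4p4 (C : abelianCat) (U V W : C -> Prop)
    (hUV : forall X : C, U X -> V X)
    (hU : extension_closed U) (hV : extension_closed V)
    (hW : relative_generator W U)
    (h0 : U zero_ob) :
  (* (a) *)
  (forall (Z : C) (n : nat), vee_in V U Z -> coresdim_is V U Z n ->
     (exists (MZ CZ : C) (g : mor Z MZ) (p : mor MZ CZ),
        envelope_seq U V W n g p) /\
     (exists (KZ BZ : C) (k : mor KZ BZ) (f : mor BZ Z),
        cover_seq U V W n k f)) /\
  (* (b) *)
  (forall (Z : C) (n : nat), vee_in V U Z -> coresdim_is V U Z n ->
     forall (KZ BZ : C) (k : mor KZ BZ) (f : mor BZ Z),
       cover_seq U V W n k f -> pair_vee V U Z -> pair_vee V W BZ) /\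
  (* (c) *)
  ((forall X : C, W X -> left_perp U X) ->
     (forall X : C, vee W X -> left_perp U X) /\
     (forall (Z : C) (n : nat), vee_in V U Z -> coresdim_is V U Z n ->
        (forall (KZ BZ : C) (k : mor KZ BZ) (f : mor BZ Z),
           cover_seq U V W n k f -> precover (vee W) f) /\
        (forall (MZ CZ : C) (g : mor Z MZ) (p : mor MZ CZ),
           envelope_seq U V W n g p -> preenvelope U g))).
Proof.
have V_iso : iso_closed V by apply: extension_closed_iso => //; apply: hUV.
split.
  move=> Z n _ [Zn Zmin]; split.
    case: n Zn Zmin => [|n] Zn Zmin.
      have [X [f [fm fe _ UX]]] := coresolution0_iso Zn.
      (* In length zero [Z] is isomorphic to an object of [U], hence is its own envelope with zero
         cokernel. *)
      exists Z, zero_ob, (idmor Z), 0; split.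
      - exact: ses_iso_zero (@idm_mono _ _) (@idm_epi _ _).
      - exact: zero_pair_vee hUV hV hW h0.
      - by apply/(extension_closed_iso hU h0 fm fe).
      exact: zero_obP.
    have [M [D [g [p [gp UM VD Dn]]]]] := envelope_exists hUV hU hV hW h0 Zn.
    exists M, D, g, p; split=> //; first by split=> //; exists n.
    (* A coresolution of [D] by [W] is also one by [U]; preceded by [M] it coresolves [Z], so its
       length plus one is at least [n.+1]. *)
    split=> // m Dm; apply: (Zmin m.+1).
    apply: coresolution_cons gp UM VD _ => //.
    by apply: coresolution_sub Dm => //; apply: hW.1.
  have [K [B [k [f [kf UK Bn]]]]] := cover_exists hUV hU hV hW h0 Zn.
  exists K, B, k, f; split=> //; first by exists n.
  exact: coresdim_exists Bn.
split.
  move=> Z n _ _ K B k f [kf Bvee UK _] [VZ _]; split=> //.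
  exact: hV kf (hUV _ UK) VZ.
move=> Wperp; have veeperp := vee_left_perp Wperp.
split=> // Z n _ _; split.
  move=> K B k f [kf Bvee UK _]; split; first exact: vee_in_vee Bvee.
  (* The obstruction to lifting [h] lies in Ext^1(Z', K), which vanishes as [K] is in [U]. *)
  by move=> Z' Z'vee h; apply: ext_lift kf _; apply: veeperp.
move=> M D g p [gp [_ Dvee] UM _]; split=> // Z' UZ' h.
(* The obstruction to extending [h] lies in Ext^1(D, Z'). *)
by apply: ext_extend gp _; apply: veeperp UZ' _; apply: vee_in_vee Dvee.
Qed.
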